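(* A timelike loxodrome on a timelike helicoidal surface of type I in $\mathbb{E}^n_1$, the surface being parametrized by $H_1(u,v)=(x_1(u)\cos v, x_1(u)\sin v, x_3(u),\dots,x_{n-1}(u),x_n(u)+cv)$, is parametrized by $\alpha_1(u)=H_1(u,v(u))$, where $v(u)$ is given by one of the following functions: (i) $$v(u)=\pm\frac{1}{2\sinh\phi_0}\int_{u_0}^u\frac{d\xi}{\sqrt{c^2-x_1^2(\xi)}};$$ (ii) $$v(u)=\pm\frac{1}{2\cosh\phi_0}\int_{u_0}^u\frac{d\xi}{\sqrt{c^2-x_1^2(\xi)}};$$ (iii) for $\sinh^2\phi_0\,(x_1^2(\xi)-c^2)+c^2x_n'^2(\xi)\neq0$, $$v(u)=\int_{u_0}^u\frac{2c\cosh^2\phi_0\,x_n'(\xi)\pm\sqrt{\sinh^2(2\phi_0)\,(c^2(x_n'^2(\xi)+1)-x_1^2(\xi))}}{2\sinh^2\phi_0\,(x_1^2(\xi)-c^2)+2c^2x_n'^2(\xi)}\,d\xi;$$ (iv) for $\cosh^2\phi_0\,(x_1^2(\xi)-c^2)+c^2x_n'^2(\xi)\neq0$, $$v(u)=\int_{u_0}^u\frac{2c\sinh^2\phi_0\,x_n'(\xi)\pm\sqrt{\sinh^2(2\phi_0)\,(c^2(x_n'^2(\xi)-1)+x_1^2(\xi))}}{2\cosh^2\phi_0\,(x_1^2(\xi)-c^2)+2c^2x_n'^2(\xi)}\,d\xi,$$ where $\phi_0$ (the constant angle of the loxodrome with the meridians) is a nonnegative constant and $c>0$ is a constant.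
   Context: $\mathbb{E}^n_1$ is $\mathbb{R}^n$ with the metric $\langle\cdot,\cdot\rangle$ given by $dx_1^2+\cdots+dx_{n-1}^2-dx_n^2$, and $\|w\|=\sqrt{|\langle w,w\rangle|}$. A vector $w$ is spacelike if $\langle w,w\rangle>0$ or $w=0$, timelike if $\langle w,w\rangle<0$; a curve is spacelike or timelike if its velocity is. Helicoidal surface of type I: let $\beta(u)=(x_1(u),0,x_3(u),\dots,x_n(u))$ be a smooth regular curve defined on an open interval $I\subset\mathbb{R}$ and parametrized by arc length, i.e. $x_1'^2+x_3'^2+\cdots+x_{n-1}'^2-x_n'^2=\varepsilon$ with $\varepsilon=\pm1$, and let $c$ be a positive constant. The surface is parametrized by $H_1(u,v)$ as in the claim, with $u\in I$ and $0\le v<2\pi$. It is timelike if $EG-F^2<0$, where $E=\langle (H_1)_u,(H_1)_u\rangle$, $F=\langle (H_1)_u,(H_1)_v\rangle$, $G=\langle (H_1)_v,(H_1)_v\rangle$; that is, $\varepsilon x_1^2(u)-c^2(\varepsilon+x_n'^2(u))<0$. The meridians are the curves $u\mapsto H_1(u,v_0)$ with $v_0$ constant; they are spacelike if $\varepsilon=1$ and timelike if $\varepsilon=-1$. Lorentzian timelike angle: for a spacelike vector $x$ and a timelike vector $y$, it is the unique nonnegative real number $\theta$ with $\langle x,y\rangle=\pm\|x\|\|y\|\sinh\theta$; for timelike vectors $x,y$, it is the unique nonnegative real number $\theta$ with $\langle x,y\rangle=\|x\|\|y\|\cosh\theta$. A timelike loxodrome on the surface is a timelike curve $\alpha_1(t)=H_1(u(t),v(t))$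 that intersects the meridians at a constant angle $\phi_0$, i.e. the Lorentzian timelike angle between its velocity and the meridian tangent vector $(H_1)_u$ is $\phi_0$ at each point. The number $u_0$ is a fixed value of the parameter $u$.
   Formalization: Assumes u'(t) is nonzero where the expression in (iii) (spacelike meridians) or (iv) (timelike) vanishes, else a helix u=const is a counterexample; formulas hold on intervals where that expression is identically or nowhere zero, with v(u_0) added as constant of integration. *)

(* Defs.v *)
From HB Require Import structures.
From mathcomp Require Import all_boot all_order all_algebra.
From mathcomp Require Import all_classical all_reals all_analysis.
Set Implicit Arguments.
Unset Strict Implicit.
Unset Printing Implicit Defensive.
Import Order.TTheory GRing.Theory Num.Theory.
Import numFieldNormedType.Exports.
Local Open Scope ring_scope.
Local Open Scope classical_set_scope.

Definition sinh (R : realType) (x : R) : R := (expR x - expR (- x)) / 2.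
Definition cosh (R : realType) (x : R) : R := (expR x + expR (- x)) / 2.

(* Riemann-style orientation: the integral from a to b is minus the integral
   over [b, a] when b < a. *)
Definition oriented_integral (R : realType) (f : R -> R) (a b : R) : R :=
  if a <= b then \int[lebesgue_measure]_(x in `[a, b]) f x
  else - \int[lebesgue_measure]_(x in `[b, a]) f x.

Definition smooth_on (R : realType) (V : normedModType R) (A : set R)
    (f : R -> V) : Prop :=
  forall (k : nat) (x : R), A x -> derivable (derive1n k f) x 1.

Definition open_interval (R : realType) (A : set R) : Prop :=
  open A /\ is_interval A.

(* The Minkowski space E^m_1 with m = n.+3, i.e. every dimension m >= 3.
   Coordinates are numbered from 0, so x_1, x_2, x_m are the coordinates
   ord0, ord_snd, ord_max; the last one is the negative direction. *)
Section Minkowski.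
Context {R : realType} {n : nat}.
Implicit Types x y : 'rV[R]_n.+3.

Definition minkowski x y : R :=
  \sum_(j < n.+3 | j != ord_max) x ord0 j * y ord0 j
  - x ord0 ord_max * y ord0 ord_max.

Definition mnorm x : R := Num.sqrt `|minkowski x x|.

Definition spacelike x : Prop := 0 < minkowski x x \/ x = 0.
Definition timelike x : Prop := minkowski x x < 0.

Definition timelike_angle x y (theta : R) : Prop :=
  0 <= theta /\
  ((spacelike x /\ timelike y /\
      (minkowski x y = mnorm x * mnorm y * sinh theta \/
       minkowski x y = - (mnorm x * mnorm y * sinh theta)))
   \/
   (timelike x /\ timelike y /\
      minkowski x y = mnorm x * mnorm y * cosh theta)).

End Minkowski.

Section Helicoidal.
Context {R : realType} {n : nat}.
Variables (beta : R -> 'rV[R]_n.+3) (c : R).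

Definition ord_snd : 'I_n.+3 := inord 1.

Definition x_first (u : R) : R := beta u ord0 ord0.
Definition x_last (u : R) : R := beta u ord0 ord_max.

Definition profile_curve (I : set R) (eps : R) : Prop :=
  (eps = 1 \/ eps = -1) /\
  smooth_on I beta /\
  (forall u, I u -> beta u ord0 ord_snd = 0) /\
  (forall u, I u -> minkowski (derive1 beta u) (derive1 beta u) = eps).

Definition H1 (u v : R) : 'rV[R]_n.+3 :=
  \row_(j < n.+3)
    if j == ord0 then x_first u * cos v
    else if j == ord_snd then x_first u * sin v
    else if j == ord_max then x_last u + c * v
    else beta u ord0 j.

Definition H1_u (u v : R) : 'rV[R]_n.+3 := derive1 (fun s => H1 s v) u.
Definition H1_v (u v : R) : 'rV[R]_n.+3 := derive1 (fun s => H1 u s) v.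

Definition ffE u v : R := minkowski (H1_u u v) (H1_u u v).
Definition ffF u v : R := minkowski (H1_u u v) (H1_v u v).
Definition ffG u v : R := minkowski (H1_v u v) (H1_v u v).

Definition timelike_surface (I : set R) : Prop :=
  forall u v, I u -> 0 <= v < 2 * pi ->
    ffE u v * ffG u v - ffF u v ^+ 2 < 0.

(* The curve t |-> H1 (u t) (v t), t in T, is a timelike loxodrome of angle
   phi0 on the surface over I x [0, 2 pi[. *)
Definition timelike_loxodrome (I T : set R) (u v : R -> R) (phi0 : R) : Prop :=
  let alpha := fun t => H1 (u t) (v t) in
  smooth_on T u /\ smooth_on T v /\
  (forall t, T t -> I (u t) /\ 0 <= v t < 2 * pi) /\
  (forall t, T t -> timelike (derive1 alpha t)) /\
  (forall t, T t -> timelike_angle (H1_u (u t) (v t)) (derive1 alpha t) phi0).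

Definition denom_sinh (phi0 xi : R) : R :=
  sinh phi0 ^+ 2 * (x_first xi ^+ 2 - c ^+ 2)
  + c ^+ 2 * (derive1 x_last xi) ^+ 2.

Definition denom_cosh (phi0 xi : R) : R :=
  cosh phi0 ^+ 2 * (x_first xi ^+ 2 - c ^+ 2)
  + c ^+ 2 * (derive1 x_last xi) ^+ 2.

(* Up to a nonzero factor, a curve of angle phi0 with the meridians satisfies
   a quadratic equation in dv/du; this is its leading coefficient, for spacelike
   (eps = 1) and timelike (eps = -1) meridians respectively. *)
Definition denom (eps phi0 xi : R) : R :=
  if eps == 1 then denom_sinh phi0 xi else denom_cosh phi0 xi.

Definition radicand_iii (phi0 xi : R) : R :=
  sinh (2 * phi0) ^+ 2
  * (c ^+ 2 * ((derive1 x_last xi) ^+ 2 + 1) - x_first xi ^+ 2).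

Definition radicand_iv (phi0 xi : R) : R :=
  sinh (2 * phi0) ^+ 2
  * (c ^+ 2 * ((derive1 x_last xi) ^+ 2 - 1) + x_first xi ^+ 2).

Definition is_sign (s : R) : Prop := s = 1 \/ s = -1.

(* In the four formulas below, K is an interval containing u0, s is the sign
   written "plus or minus" (the same for all u), and w u0 is the constant of
   integration. Since division and square root are total, the conditions that
   make the integrand meaningful on K are part of each formula. *)
Section Formulas.
Variables (K : set R) (phi0 u0 : R) (w : R -> R).

Definition formula_i : Prop :=
  sinh phi0 != 0 /\
  (forall xi, K xi -> 0 < c ^+ 2 - x_first xi ^+ 2) /\
  exists s, is_sign s /\ forall u, K u ->
    w u = w u0 + s * ((2 * sinh phi0)^-1 *
      oriented_integral
        (fun xi => (Num.sqrt (c ^+ 2 - x_first xi ^+ 2))^-1) u0 u).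

Definition formula_ii : Prop :=
  (forall xi, K xi -> 0 < c ^+ 2 - x_first xi ^+ 2) /\
  exists s, is_sign s /\ forall u, K u ->
    w u = w u0 + s * ((2 * cosh phi0)^-1 *
      oriented_integral
        (fun xi => (Num.sqrt (c ^+ 2 - x_first xi ^+ 2))^-1) u0 u).

Definition formula_iii : Prop :=
  (forall xi, K xi -> denom_sinh phi0 xi != 0) /\
  (forall xi, K xi -> 0 <= radicand_iii phi0 xi) /\
  exists s, is_sign s /\ forall u, K u ->
    w u = w u0 + oriented_integral (fun xi =>
      (2 * c * cosh phi0 ^+ 2 * derive1 x_last xi
         + s * Num.sqrt (radicand_iii phi0 xi))
      / (2 * sinh phi0 ^+ 2 * (x_first xi ^+ 2 - c ^+ 2)
         + 2 * c ^+ 2 * (derive1 x_last xi) ^+ 2)) u0 u.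

Definition formula_iv : Prop :=
  (forall xi, K xi -> denom_cosh phi0 xi != 0) /\
  (forall xi, K xi -> 0 <= radicand_iv phi0 xi) /\
  exists s, is_sign s /\ forall u, K u ->
    w u = w u0 + oriented_integral (fun xi =>
      (2 * c * sinh phi0 ^+ 2 * derive1 x_last xi
         + s * Num.sqrt (radicand_iv phi0 xi))
      / (2 * cosh phi0 ^+ 2 * (x_first xi ^+ 2 - c ^+ 2)
         + 2 * c ^+ 2 * (derive1 x_last xi) ^+ 2)) u0 u.

End Formulas.

End Helicoidal.

(* Main.v *)
(* With kap = sinh phi0 for spacelike meridians (eps = 1) and kap = cosh phi0 for
   timelike ones (eps = -1), the angle condition squared reads
     <H_u, alpha'>^2 = - kap^2 <alpha', alpha'>.
   Writing out the first fundamental form E = eps, F = - c x_n', G = x_1^2 - c^2,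
   this is a quadratic equation in (u', v'):
     D v'^2 - 2 c x_n' (kap^2 + eps) u' v' + eps (kap^2 + eps) u'^2 = 0,
   with D = kap^2 G + c^2 x_n'^2. If u' = 0 then v' <> 0 and D = 0, which
   transversality excludes; so u is injective, the curve is a graph v = w(u), and
   w' solves a quadratic equation whose discriminant, up to the factor
   sinh^2 (2 phi0), is F^2 - EG > 0. The branch of the square root is therefore
   constant on an interval where D does not vanish; where D = 0 the equation is
   linear and its solution w' = eps / (2 c x_n') has constant sign. Formulas
   (i)-(iv) follow by integration. *)
Require Import Defs.
From HB Require Import structures.
From mathcomp Require Import all_boot all_order all_algebra.
From mathcomp Require Import all_classical all_reals all_analysis.
From mathcomp Require Import ring.
Set Implicit Arguments.
Unset Strict Implicit.
Unset Printing Implicit Defensive.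
Import Order.TTheory GRing.Theory Num.Theory.
Import numFieldNormedType.Exports.
Local Open Scope ring_scope.
Local Open Scope classical_set_scope.

(** * Real analysis: constancy of sign, oriented integration, differentiable inverses *)

Section RealAnalysis.
Context {R : realType}.
Implicit Types (A K T : set R) (f g h u w : R -> R) (x y z t l : R).

Lemma is_derive1_continuous f x l : is_derive x 1 f l -> {for x, continuous f}.
Proof. by case=> df _; exact/differentiable_continuous/derivable1_diffP. Qed.

(** Two values of opposite sign would force a zero between them, by the intermediate value theorem.
    The form [g x = s * |g x|] yields one sign for the whole of [K], as the formulas require. *)
Lemma continuous_nonvanishing_sign K g : is_interval K ->
  (forall x, K x -> {for x, continuous g}) -> (forall x, K x -> g x != 0) ->
  exists s : R, is_sign s /\ forall x, K x -> g x = s * `|g x|.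
Proof.
move=> itvK cg g0.
have noswitch x y : K x -> K y -> x <= y ->
    Num.min (g x) (g y) <= 0 <= Num.max (g x) (g y) -> False.
  move=> Kx Ky xy /(IVT xy)[|z zxy gz0].
    apply: continuous_in_subspaceT => z; rewrite inE/= => zxy; apply: cg.
    by apply: (itvK _ _ Kx Ky); rewrite !(itvP zxy).
  have /eqP := gz0; apply/negP/g0.
  by apply: (itvK _ _ Kx Ky); rewrite !(itvP zxy).
have [[x0 Kx0 gx0]|allneg] := pselect (exists2 x, K x & 0 < g x).
  exists 1; split=> [|x Kx]; first by left.
  rewrite mul1r ger0_norm//; case: (lerP 0 (g x)) => // gx.
  exfalso; case: (lerP x x0) => [xx0|/ltW x0x].
    by apply: (noswitch x x0) => //; rewrite ge_min le_max (ltW gx) (ltW gx0) orbT.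
  by apply: (noswitch x0 x) => //; rewrite ge_min le_max (ltW gx) (ltW gx0) orbT.
exists (-1); split=> [|x Kx]; first by right.
rewrite ler0_norm ?mulrNN ?mul1r//; case: (lerP (g x) 0) => // gx.
by exfalso; apply: allneg; exists x.
Qed.

Lemma FTC_oriented K f w x0 : is_interval K -> K x0 ->
  (forall x, K x -> is_derive x 1 w (f x)) ->
  (forall x, K x -> {for x, continuous f}) ->
  forall x, K x -> w x = w x0 + oriented_integral f x0 x.
Proof.
move=> itvK Kx0 dw cf.
have FTC a b : K a -> K b -> a < b ->
    \int[lebesgue_measure]_(x in `[a, b]) f x = w b - w a.
  move=> Ka Kb ab.
  have Kab z : a <= z <= b -> K z by apply: itvK.
  rewrite /Rintegral (@continuous_FTC2 _ f w _ _ ab)//.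
  - apply: continuous_in_subspaceT => z; rewrite inE/= => zab; apply: cf.
    by apply: Kab; rewrite !(itvP zab).
  - split.
    + by move=> z zab; case: (dw z) => //; apply: Kab; rewrite !ltW ?(itvP zab).
    + by apply/cvg_at_right_filter/(is_derive1_continuous (dw _ Ka)).
    + by apply/cvg_at_left_filter/(is_derive1_continuous (dw _ Kb)).
  - move=> z zab; rewrite derive1E; apply: (@derive_val _ _ _ _ _ _ _ (dw z _)).
    by apply: Kab; rewrite !ltW ?(itvP zab).
move=> x Kx; rewrite /oriented_integral.
case: (ltgtP x0 x) => [ux|xx0|<-].
- by rewrite FTC// addrC subrK.
- by rewrite FTC// opprB addrC subrK.
- by rewrite set_itv1 Rintegral_set1 addr0.
Qed.

Lemma eq_oriented_integral K f g x0 x : is_interval K -> K x0 -> K x ->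
  (forall z, K z -> f z = g z) ->
  oriented_integral f x0 x = oriented_integral g x0 x.
Proof.
move=> itvK Kx0 Kx fg; rewrite /oriented_integral; case: (lerP x0 x) => x0x.
- apply: eq_Rintegral => z; rewrite inE/= => zI; apply: fg.
  by apply: (itvK _ _ Kx0 Kx); rewrite !(itvP zI).
- congr (- _); apply: eq_Rintegral => z; rewrite inE/= => zI; apply: fg.
  by apply: (itvK _ _ Kx Kx0); rewrite !(itvP zI).
Qed.

(** Here [h] is the explicit integrand of a formula: continuity is asked of the true derivative [f],
    and [h] has to agree with it on [K] only. *)
Lemma FTC_oriented_eq K f h w x0 : is_interval K -> K x0 ->
  (forall x, K x -> is_derive x 1 w (f x)) ->
  (forall x, K x -> {for x, continuous f}) ->
  (forall x, K x -> f x = h x) ->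
  forall x, K x -> w x = w x0 + oriented_integral h x0 x.
Proof.
move=> itvK Kx0 dw cf fh x Kx.
rewrite -(@eq_oriented_integral K f)//.
exact: FTC_oriented dw cf x Kx.
Qed.

(** Rolle's theorem: two equal values would give a critical point between them. *)
Lemma derive_nonvanishing_inj T u : is_interval T ->
  (forall t, T t -> derivable u t 1) -> (forall t, T t -> derive1 u t != 0) ->
  forall t1 t2, T t1 -> T t2 -> u t1 = u t2 -> t1 = t2.
Proof.
move=> itvT du u'0.
have inj t1 t2 : T t1 -> T t2 -> t1 < t2 -> u t1 = u t2 -> False.
  move=> T1 T2 t12 u12.
  have Tt z : t1 <= z <= t2 -> T z by apply: itvT.
  have [||z zt dx0] := @Rolle _ u _ _ t12 _ _ u12.
  - by move=> z zt; apply/du/Tt; rewrite !ltW ?(itvP zt).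
  - apply: derivable_within_continuous => z zt.
    by apply/du/Tt; rewrite !(itvP zt).
  - have /eqP : derive1 u z = 0 by rewrite derive1E derive_val.
    by apply/negP/u'0/Tt; rewrite !ltW ?(itvP zt).
move=> t1 t2 T1 T2 u12.
case: (ltgtP t1 t2) => // t12; exfalso; first exact: inj u12.
by apply: inj (esym u12).
Qed.

Lemma derive_inverse T u : open_interval T ->
  (forall t, T t -> derivable u t 1) -> (forall t, T t -> derive1 u t != 0) ->
  exists g, (forall t, T t -> g (u t) = t) /\
    (forall t, T t -> is_derive (u t) 1 g (derive1 u t)^-1).
Proof.
move=> [oT itvT] du u'0.
have uinj := derive_nonvanishing_inj itvT du u'0.
(* The inverse is obtained by choice, with the default value 0 outside the image of [T]. *)
pose g y := xget 0 [set t | T t /\ u t = y].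
have gK t : T t -> g (u t) = t.
  move=> Tt; rewrite /g; case: xgetP => [z _ [Tz uz]|/(_ t)/=].
    exact: uinj.
  by case.
exists g; split=> // t Tt.
have nT : \forall z \near t, T z by exact: open_nbhs_nbhs.
apply: is_derive_inverse (u'0 _ Tt).
- by near=> z; apply: gK; near: z.
- near=> z; apply/differentiable_continuous/derivable1_diffP/du; by near: z.
- by rewrite derive1E; apply: DeriveDef => //; exact: du.
Unshelve. all: by end_near. Qed.

End RealAnalysis.

(* [minkowski] alone is Minkowski's inequality from mathcomp-analysis. *)
Local Notation minkowski := Defs.minkowski.

(** * Tangent vectors and the first fundamental form *)

Section Geometry.
Context {R : realType} {n : nat}.
Variables (beta : R -> 'rV[R]_n.+3) (c : R).

Lemma ord_snd_neq0 : (@ord_snd n == ord0) = false.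
Proof. by apply/eqP => /(congr1 val); rewrite /= inordK. Qed.

Lemma ord_snd_neq_max : (@ord_snd n == ord_max) = false.
Proof. by apply/eqP => /(congr1 val); rewrite /= inordK. Qed.

(** The isolated coordinates are those that the helicoidal motion changes; the others are copied
    from [beta]. *)
Lemma minkowski_split (x y : 'rV[R]_n.+3) :
  minkowski x y = x ord0 ord0 * y ord0 ord0 + x ord0 ord_snd * y ord0 ord_snd
    + \sum_(j < n.+3 | [&& j != ord_max, j != ord0 & j != ord_snd])
        x ord0 j * y ord0 j
    - x ord0 ord_max * y ord0 ord_max.
Proof.
rewrite /Defs.minkowski (bigD1 ord0)//= (bigD1 ord_snd)/=; last first.
  by rewrite ord_snd_neq0 ord_snd_neq_max.
by rewrite addrA; under eq_bigl do rewrite -andbA.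
Qed.

(** The tangent vector a H_u + b H_v at the parameters (s, v). *)
Definition H1_tangent (s v a b : R) : 'rV[R]_n.+3 :=
  \row_(j < n.+3)
    if j == ord0
    then a * (derive1 beta s ord0 ord0 * cos v) - b * (x_first beta s * sin v)
    else if j == ord_snd
    then a * (derive1 beta s ord0 ord0 * sin v) + b * (x_first beta s * cos v)
    else if j == ord_max then a * derive1 beta s ord0 ord_max + b * c
    else a * derive1 beta s ord0 j.

Lemma is_derive_coord s j : derivable beta s 1 ->
  is_derive s 1 (fun s => beta s ord0 j) (derive1 beta s ord0 j).
Proof.
move=> db; apply: DeriveDef; first exact: (derivable_mxP _ _ _).1.
by rewrite derive1E derive_mx// mxE.
Qed.

(** The chain rule in each coordinate. Allowing arbitrary [u] and [v] covers the loxodrome and both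
    families of coordinate curves. *)
Lemma derive1_H1 (u v : R -> R) (t a b : R) : derivable beta (u t) 1 ->
  is_derive t 1 u a -> is_derive t 1 v b ->
  derive1 (fun t => H1 beta c (u t) (v t)) t = H1_tangent (u t) (v t) a b.
Proof.
move=> db du dv.
have dX j : is_derive t 1 (fun t => beta (u t) ord0 j)
    (derive1 beta (u t) ord0 j * a).
  exact: (is_derive1_comp (is_derive_coord j db)).
have dcos : is_derive t 1 (fun t => cos (v t)) (- sin (v t) * b).
  exact: is_derive1_comp.
have dsin : is_derive t 1 (fun t => sin (v t)) (cos (v t) * b).
  exact: is_derive1_comp.
have dH j : is_derive t 1 (fun t => H1 beta c (u t) (v t) ord0 j)
    (H1_tangent (u t) (v t) a b ord0 j).
  rewrite mxE; under eq_fun do rewrite mxE.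
  have [_|_] := eqVneq j ord0.
    apply: (is_derive_eq (is_deriveM (dX ord0) dcos)).
    by rewrite /x_first /GRing.scale/=; ring.
  have [_|_] := eqVneq j ord_snd.
    apply: (is_derive_eq (is_deriveM (dX ord0) dsin)).
    by rewrite /x_first /GRing.scale/=; ring.
  have [_|_] := eqVneq j ord_max; last by rewrite mulrC.
  apply: (is_derive_eq (is_deriveD (dX ord_max) (is_deriveZ c dv))).
  by rewrite /GRing.scale/=; ring.
rewrite derive1E derive_mx; last first.
  by apply/derivable_mxP => i j; rewrite (ord1 i); case: (dH j).
by apply/rowP => j; rewrite mxE derive_val.
Qed.

Section FundamentalForm.
Variables (I : set R) (eps : R).
Hypotheses (hI : open_interval I) (hbeta : profile_curve beta I eps).

Lemma profile_derivable s : I s -> derivable beta s 1.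
Proof. by case: hbeta => _ [smooth _]; exact: (smooth 0). Qed.

Lemma profile_derive_snd s : I s -> derive1 beta s ord0 ord_snd = 0.
Proof.
move=> Is; have [oI _] := hI; have [_ [_ [beta0 _]]] := hbeta.
have dsnd := is_derive_coord ord_snd (profile_derivable Is).
rewrite -(derive_val (is_derive := dsnd)).
rewrite (@near_eq_derive _ _ _ _ (cst 0))// ?derive_cst//.
have : \forall z \near s, I z by exact: open_nbhs_nbhs.
by apply: filterS => z /beta0.
Qed.

(** The polarized first fundamental form, with E = eps by arc length, F = - c x_n' and G = x_1^2 -
    c^2. *)
Lemma minkowski_H1_tangent s v a b a' b' : I s ->
  minkowski (H1_tangent s v a b) (H1_tangent s v a' b') =
  a * a' * eps - c * derive1 beta s ord0 ord_max * (a * b' + a' * b)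
  + b * b' * (x_first beta s ^+ 2 - c ^+ 2).
Proof.
move=> Is; have [_ [_ [_ /(_ _ Is)]]] := hbeta.
rewrite !minkowski_split profile_derive_snd// => <-.
rewrite !mxE eqxx ord_snd_neq0 eqxx /= [ord_max == ord_snd]eq_sym.
rewrite ord_snd_neq_max eqxx.
under eq_bigr => j /and3P[/negbTE jm /negbTE j0 /negbTE j1].
  rewrite !mxE jm j0 j1 mulrACA; over.
rewrite -mulr_sumr.
apply/eqP; rewrite -subr_eq0; set X' := derive1 beta s ord0 ord0.
(* With [eps] expanded as the square of the velocity of [beta], both sides differ by a multiple of
   cos^2 + sin^2 - 1. *)
rewrite [X in X == _](_ : _ = (cos v ^+ 2 + sin v ^+ 2 - 1)
  * (a * a' * X' ^+ 2 + b * b' * x_first beta s ^+ 2)); last by ring.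
by rewrite cos2Dsin2 subrr mul0r.
Qed.

Lemma H1_uE s v : I s -> H1_u beta c s v = H1_tangent s v 1 0.
Proof.
by move=> Is; rewrite /H1_u (@derive1_H1 id (cst v) s 1 0)//; exact: profile_derivable.
Qed.

Lemma H1_vE s v : I s -> H1_v beta c s v = H1_tangent s v 0 1.
Proof.
by move=> Is; rewrite /H1_v (@derive1_H1 (cst s) id v 0 1)//; exact: profile_derivable.
Qed.

(** This is EG - F^2 < 0, taken at v = 0 because the coefficients do not depend on v. *)
Lemma timelike_surface_ineq s : timelike_surface beta c I -> I s ->
  eps * (x_first beta s ^+ 2 - c ^+ 2)
  < c ^+ 2 * (derive1 beta s ord0 ord_max) ^+ 2.
Proof.
move=> /(_ s 0) + Is => /(_ Is); rewrite lexx mulr_gt0 ?pi_gt0// => /(_ isT).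
rewrite /ffE /ffF /ffG H1_uE// H1_vE// !minkowski_H1_tangent// => h.
rewrite -subr_lt0; congr (_ < 0): h; ring.
Qed.

End FundamentalForm.
End Geometry.

(** * The angle condition in squared form *)

Section Angle.
Context {R : realType} {n : nat}.
Implicit Types x y : 'rV[R]_n.+3.

Lemma timelike_mnorm_sqr y : timelike y -> mnorm y ^+ 2 = - minkowski y y.
Proof.
by move=> ylt; rewrite /mnorm sqr_sqrtr// ltr0_norm.
Qed.

Lemma minkowski0l y : minkowski 0 y = 0.
Proof.
by rewrite /Defs.minkowski big1 => [|j _]; rewrite mxE mul0r ?subr0.
Qed.

(** Squaring removes the ambiguous sign in the definition of the angle and the square roots in the
    norms. *)
Lemma timelike_angle_spacelike_sqr x y theta : minkowski x x = 1 ->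
  timelike_angle x y theta ->
  minkowski x y ^+ 2 = - minkowski y y * sinh theta ^+ 2.
Proof.
move=> x1 [_ [[_ [ty xy]]|[]]]; last by rewrite /timelike x1 ltr10.
have nx : mnorm x = 1 by rewrite /mnorm x1 normr1 sqrtr1.
rewrite -(timelike_mnorm_sqr ty) -exprMn.
by case: xy => ->; rewrite nx mul1r ?sqrrN.
Qed.

Lemma timelike_angle_timelike_sqr x y theta : minkowski x x = -1 ->
  timelike_angle x y theta ->
  minkowski x y ^+ 2 = - minkowski y y * cosh theta ^+ 2.
Proof.
move=> x1 [_ [[[x_gt0|x0] _]|[_ [ty xy]]]].
- by move: x_gt0; rewrite x1 oppr_gt0 ltr10.
- by move: x1; rewrite x0 minkowski0l => /eqP; rewrite eq_sym oppr_eq0 oner_eq0.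
have nx : mnorm x = 1 by rewrite /mnorm x1 normrN normr1 sqrtr1.
by rewrite -(timelike_mnorm_sqr ty) -exprMn xy nx mul1r.
Qed.

End Angle.

(** * Hyperbolic identities *)

Section Hyperbolic.
Context {R : realType}.
Implicit Type x : R.

Lemma cosh_sqr x : cosh x ^+ 2 = sinh x ^+ 2 + 1.
Proof.
rewrite -[X in _ = _ + X](expRxMexpNx_1 x) /cosh /sinh.
by move: (expR x) (expR (- x)) => p q; field.
Qed.

Lemma sinh_double x : sinh (2 * x) = 2 * sinh x * cosh x.
Proof.
rewrite /cosh /sinh -mulrN !mulr_natl !mulr2n !expRD.
by move: (expR x) (expR (- x)) => p q; field.
Qed.

Lemma cosh_gt0 x : 0 < cosh x.
Proof. by rewrite /cosh divr_gt0// addr_gt0// expR_gt0. Qed.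

Lemma sinh_ge0 x : 0 <= x -> 0 <= sinh x.
Proof.
move=> x0; rewrite /sinh divr_ge0// subr_ge0 ler_expR.
by rewrite (le_trans _ x0)// oppr_le0.
Qed.

End Hyperbolic.

(** * Solving the quadratic equation for the slope and integrating *)

Section SlopeEquation.
Context {R : realType}.
Variables (eps c kap : R) (K : set R) (X Z y w : R -> R) (x0 : R).
Hypotheses (eps2 : eps ^+ 2 = 1) (itvK : is_interval K) (Kx0 : K x0).
Hypotheses (dw : forall x, K x -> is_derive x 1 w (y x)).
Hypotheses (cy : forall x, K x -> {for x, continuous y}).
Hypothesis surf : forall x, K x ->
  eps * (X x ^+ 2 - c ^+ 2) < c ^+ 2 * Z x ^+ 2.
(* The equation of a curve of slope [y = dv/du], with [X] for x_1, [Z] for x_n'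
   and [kap] for sinh phi0 or cosh phi0 according to the sign of [eps]. *)
Hypothesis slope : forall x, K x ->
  (kap ^+ 2 * (X x ^+ 2 - c ^+ 2) + c ^+ 2 * Z x ^+ 2) * y x ^+ 2
  - 2 * c * Z x * (kap ^+ 2 + eps) * y x + eps * (kap ^+ 2 + eps) = 0.

(* If [kap ^+ 2 + eps] vanished, [surf] would say that the leading coefficient
   is positive; hence the remaining linear equation gives [2 * c * Z * y = eps]. *)
Lemma slope_degenerate : 0 <= kap ->
  (forall x, K x ->
     kap ^+ 2 * (X x ^+ 2 - c ^+ 2) + c ^+ 2 * Z x ^+ 2 = 0) ->
  kap != 0 /\ (forall x, K x -> 0 < c ^+ 2 - X x ^+ 2) /\
  exists s, is_sign s /\ forall x, K x ->
    w x = w x0 + s * ((2 * kap)^-1 *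
      oriented_integral (fun x => (Num.sqrt (c ^+ 2 - X x ^+ 2))^-1) x0 x).
Proof.
move=> kap_ge0 D0.
have eps0 : eps != 0 by rewrite -sqrf_eq0 eps2 oner_eq0.
have yE x : K x -> 2 * (c * Z x) * y x = eps.
  move=> Kx; have k0 : kap ^+ 2 + eps != 0.
    apply/negP => /eqP k0; have := surf Kx; have := D0 _ Kx.
    have -> : kap ^+ 2 = - eps by apply/eqP; rewrite -addr_eq0 k0.
    by move=> D0x; rewrite -subr_gt0 addrC -mulNr D0x ltxx.
  apply: (mulfI k0); have := slope Kx; rewrite D0// => h.
  by apply/eqP; rewrite eq_sym -subr_eq0 -h; apply/eqP; ring.
have sqE x : K x -> kap ^+ 2 * (c ^+ 2 - X x ^+ 2) = (c * Z x) ^+ 2.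
  by move=> Kx; apply/eqP; rewrite eq_sym -subr_eq0 -(D0 x Kx); apply/eqP; ring.
have cZ0 x : K x -> c * Z x != 0.
  move=> /yE yx; apply: contra_neq eps0 => cZ0.
  by rewrite -yx cZ0 mulr0 mul0r.
have kap0 : kap != 0.
  have := cZ0 _ Kx0; rewrite -sqrf_eq0 -sqE//; apply: contra_neq => ->.
  by rewrite expr0n mul0r.
have kap_gt0 : 0 < kap by rewrite lt_neqAle eq_sym kap0.
have X_lt x : K x -> 0 < c ^+ 2 - X x ^+ 2.
  move=> Kx; rewrite -(@pmulr_rgt0 _ (kap ^+ 2)) ?exprn_gt0// sqE//.
  by rewrite lt_neqAle sqr_ge0 andbT eq_sym sqrf_eq0 cZ0.
split=> //; split=> //.
have [s [sgs ys]] : exists s : R, is_sign s /\ forall x, K x -> y x = s * `|y x|.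
  apply: continuous_nonvanishing_sign => // x /yE yx.
  by apply: contra_neq eps0 => y0; rewrite -yx y0 mulr0.
exists s; split=> // x Kx.
have s2 : s * s = 1 by case: sgs => ->; rewrite ?mulrNN mulr1.
(* The factor [2 * kap * s] makes the derivative equal to the bare integrand: the square of 2 kap
   |y| sqrt(c^2 - X^2) is (2 c Z y)^2 = eps^2 = 1. *)
have := @FTC_oriented_eq _ K (fun x => 2 * kap * s * y x)
  (fun x => (Num.sqrt (c ^+ 2 - X x ^+ 2))^-1) (fun x => 2 * kap * s * w x)
  x0 itvK Kx0 _ _ _ x Kx.
move=> /(_ _ _ _)/wrap[x1 Kx1|x1 Kx1|x1 Kx1|].
- exact: (is_deriveZ (2 * kap * s) (dw Kx1)).
- by apply: cvgM; [exact: cvg_cst|exact: cy].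
- have r0 : 0 < Num.sqrt (c ^+ 2 - X x1 ^+ 2) by rewrite sqrtr_gt0 X_lt.
  rewrite ys// mulrA -[2 * kap * s * s]mulrA s2 mulr1.
  apply: (mulIf (lt0r_neq0 r0)); rewrite mulVf ?lt0r_neq0//.
  apply: (@pexpIrn _ 2) => //; rewrite ?nnegrE ?mulr_ge0// ?(ltW r0)//.
  rewrite expr1n !exprMn sqr_sqrtr ?(ltW (X_lt _ Kx1))//.
  rewrite real_normK ?num_real// -[RHS]eps2 -(yE _ Kx1).
  by rewrite [RHS]exprMn [X in _ = X * _]exprMn -sqE//; ring.
- set J := oriented_integral _ _ _ => E.
  have -> : J = 2 * kap * (s * (w x - w x0)) by rewrite mulrA mulrBr E addrC addKr.
  by rewrite mulKf ?mulf_neq0 ?pnatr_eq0// mulrA s2 mul1r addrC subrK.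
Qed.

(** The quadratic formula with one branch on all of [K]. The constant [k] will be sinh^2 (2 phi0)
    for either value of [eps]. *)
Lemma slope_nondegenerate (k : R) :
  (forall x, K x -> {for x, continuous X}) ->
  (forall x, K x -> {for x, continuous Z}) ->
  (forall x, K x ->
     kap ^+ 2 * (X x ^+ 2 - c ^+ 2) + c ^+ 2 * Z x ^+ 2 != 0) ->
  k = 4 * kap ^+ 2 * (kap ^+ 2 + eps) ->
  exists s, is_sign s /\ forall x, K x ->
    w x = w x0 + oriented_integral (fun x =>
      (2 * c * (kap ^+ 2 + eps) * Z x
         + s * Num.sqrt (k * (c ^+ 2 * Z x ^+ 2 - eps * (X x ^+ 2 - c ^+ 2))))
      / (2 * kap ^+ 2 * (X x ^+ 2 - c ^+ 2) + 2 * c ^+ 2 * Z x ^+ 2)) x0 x.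
Proof.
move=> cX cZ D0 kE.
pose D x := kap ^+ 2 * (X x ^+ 2 - c ^+ 2) + c ^+ 2 * Z x ^+ 2.
(* Completing the square turns [slope] into [g ^+ 2 = r], and [surf] makes [r]
   positive unless [k = 0], so that the sign of [g] is constant on [K]. *)
pose g x := 2 * D x * y x - 2 * c * (kap ^+ 2 + eps) * Z x.
pose r x := k * (c ^+ 2 * Z x ^+ 2 - eps * (X x ^+ 2 - c ^+ 2)).
have gE x : K x -> g x ^+ 2 = r x.
  (* The difference [g x ^+ 2 - r x] is [4 * D x] times the left side of [slope]. *)
  move=> /slope sl; apply/eqP; rewrite -subr_eq0.
  rewrite -[X in _ == X](mulr0 (4 * D x)) -sl /g /r kE /D; apply/eqP.
  ring: eps2.
have [s [sgs gs]] : exists s : R, is_sign s /\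
    forall x, K x -> g x = s * Num.sqrt (r x).
  (* If [k = 0], both [g] and [r] vanish on [K] and either sign serves. *)
  have [k0|k0] := eqVneq k 0.
    exists 1; split=> [|x Kx]; first by left.
    have := gE x Kx; rewrite /r k0 mul0r sqrtr0 mulr0 => /eqP.
    by rewrite sqrf_eq0 => /eqP.
  have [x Kx|x Kx|s [sgs gs]] := @continuous_nonvanishing_sign _ K g itvK.
  - have cD : {for x, continuous D}.
      apply: cvgD; apply: cvgM; try exact: cvg_cst.
        by apply: cvgB; [apply: cvgM; exact: cX|exact: cvg_cst].
      by apply: cvgM; exact: cZ.
    apply: cvgB; apply: cvgM; try exact: cvg_cst.
    + by apply: cvgM; [exact: cvg_cst|exact: cD].
    + exact: cy.
    + exact: cZ.
  - by rewrite -sqrf_eq0 gE// mulf_neq0// subr_eq0 gt_eqF//; exact: surf.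
  - by exists s; split=> // x Kx; rewrite -gE// sqrtr_sqr; exact: gs.
exists s; split=> // x Kx.
apply: (FTC_oriented_eq itvK Kx0 dw cy) => // x1 Kx1.
rewrite -/(r x1) -gs// /g addrC subrK.
have -> : 2 * kap ^+ 2 * (X x1 ^+ 2 - c ^+ 2) + 2 * c ^+ 2 * Z x1 ^+ 2 = 2 * D x1.
  by rewrite /D; ring.
by rewrite [_ * y x1]mulrC mulfK// mulf_neq0 ?pnatr_eq0// D0.
Qed.

End SlopeEquation.

(** * The equation satisfied by the velocity of a loxodrome *)

Section Loxodrome.
Context {R : realType} {n : nat}.
Variables (I : set R) (beta : R -> 'rV[R]_n.+3) (eps c phi0 : R) (T : set R).
Variables (u v : R -> R).
Hypotheses (hI : open_interval I) (hbeta : profile_curve beta I eps).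
Hypothesis hlox : timelike_loxodrome beta c I T u v phi0.

Let kap : R := if eps == 1 then sinh phi0 else cosh phi0.

Lemma denomE s : denom beta c eps phi0 s =
  kap ^+ 2 * (x_first beta s ^+ 2 - c ^+ 2) + c ^+ 2 * (derive1 (x_last beta) s) ^+ 2.
Proof. by rewrite /denom /kap; case: ifP. Qed.

Lemma derive1_x_last s : I s ->
  derive1 (x_last beta) s = derive1 beta s ord0 ord_max.
Proof.
move=> /(profile_derivable hbeta) db.
by rewrite derive1E (derive_val (is_derive := is_derive_coord ord_max db)).
Qed.

(** Here [q] is <alpha', alpha'> and [eps * a - c * Z * b] is <H_u, alpha'>; [kap] lets one identity
    cover both kinds of meridian. *)
Lemma loxodrome_velocity t : T t -> let s := u t in
  let a := derive1 u t in let b := derive1 v t in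
  let Z := derive1 (x_last beta) s in
  let q := eps * a ^+ 2 - 2 * c * Z * a * b + (x_first beta s ^+ 2 - c ^+ 2) * b ^+ 2 in
  q < 0 /\ (eps * a - c * Z * b) ^+ 2 = - q * kap ^+ 2.
Proof.
move=> Tt; have [su [sv [/(_ _ Tt)[Iu _] [/(_ _ Tt) tl /(_ _ Tt) ang]]]] := hlox.
rewrite /= derive1_x_last//.
have du : is_derive t 1 u (derive1 u t).
  by rewrite derive1E; apply: DeriveDef => //; exact: (su 0).
have dv : is_derive t 1 v (derive1 v t).
  by rewrite derive1E; apply: DeriveDef => //; exact: (sv 0).
have db := profile_derivable hbeta Iu.
rewrite (derive1_H1 c db du dv) (H1_uE c hbeta _ Iu) in tl ang.
have mE := minkowski_H1_tangent c hI hbeta (v t) _ _ _ _ Iu.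
have Huu : minkowski (H1_tangent beta c (u t) (v t) 1 0)
    (H1_tangent beta c (u t) (v t) 1 0) = eps by rewrite mE; ring.
rewrite /timelike mE in tl.
set q := (X in X < 0); rewrite -/q; have qE : q = minkowski
  (H1_tangent beta c (u t) (v t) (derive1 u t) (derive1 v t))
  (H1_tangent beta c (u t) (v t) (derive1 u t) (derive1 v t)).
  by rewrite mE /q; ring.
split; first by rewrite qE mE.
have -> : eps * derive1 u t - c * derive1 beta (u t) ord0 ord_max * derive1 v t =
  minkowski (H1_tangent beta c (u t) (v t) 1 0)
    (H1_tangent beta c (u t) (v t) (derive1 u t) (derive1 v t)) by rewrite mE; ring.
rewrite qE /kap; have [eps1|] := eqVneq eps 1.
  by apply: timelike_angle_spacelike_sqr => //; rewrite Huu.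
case: hbeta => -[->|eps1 _ _]; first by rewrite eqxx.
by apply: timelike_angle_timelike_sqr => //; rewrite Huu.
Qed.

End Loxodrome.

(** * Loxodromes as graphs v = w(u), and the four formulas *)

Theorem theorem3p2 (R : realType) (n : nat) (I : set R)
    (beta : R -> 'rV[R]_n.+3) (eps c phi0 : R) (T : set R) (u v : R -> R)
    (hI : open_interval I) (hbeta : profile_curve beta I eps) (hc : 0 < c)
    (hsurf : timelike_surface beta c I)
    (hphi0 : 0 <= phi0) (hT : open_interval T)
    (hlox : timelike_loxodrome beta c I T u v phi0)
    (htransv : forall t, T t -> denom beta c eps phi0 (u t) = 0 ->
       derive1 u t <> 0) :
  (forall t, T t -> derive1 u t <> 0) /\
  (forall t1 t2, T t1 -> T t2 -> u t1 = u t2 -> t1 = t2) /\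
  exists w : R -> R,
    (forall t, T t -> H1 beta c (u t) (v t) = H1 beta c (u t) (w (u t))) /\
    forall (K : set R) (u0 : R),
      is_interval K -> K u0 -> K `<=` u @` T ->
      (forall xi, K xi -> denom beta c eps phi0 xi = 0) \/
      (forall xi, K xi -> denom beta c eps phi0 xi <> 0) ->
      formula_i beta c K phi0 u0 w \/
      formula_ii beta c K phi0 u0 w \/
      formula_iii beta c K phi0 u0 w \/
      formula_iv beta c K phi0 u0 w.
Proof.
have [su [sv [hIv _]]] := hlox.
have eps2 : eps ^+ 2 = 1 by case: hbeta => -[->|->] _; rewrite ?sqrrN expr1n.
set kap := if eps == 1 then sinh phi0 else cosh phi0.
have vel t := @loxodrome_velocity R n I beta eps c phi0 T u v hI hbeta hlox t.
have du t : T t -> derivable u t 1 by exact: (su 0).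
have u'0 t : T t -> derive1 u t != 0.
  move=> Tt; apply/negP => /eqP a0.
  have := vel t Tt; rewrite /= a0 !mulr0 !mul0r subr0 add0r expr0n/= mulr0 add0r.
  move=> [q_lt0 qE]; apply: (htransv t Tt) a0.
  have b0 : derive1 v t ^+ 2 != 0.
    by apply: contraTneq q_lt0 => ->; rewrite mulr0 ltxx.
  apply: (mulIf b0); rewrite mul0r denomE -/kap.
  (* At u' = 0 the squared angle condition is exactly D v'^2 = 0. *)
  transitivity ((- (c * derive1 (x_last beta) (u t) * derive1 v t)) ^+ 2
    - - ((x_first beta (u t) ^+ 2 - c ^+ 2) * derive1 v t ^+ 2) * kap ^+ 2).
    by ring.
  by rewrite -qE subrr.
have [g [gK dg]] := derive_inverse hT du u'0.
split; first by move=> t Tt; apply/eqP/u'0.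
split; first by case: hT => _ itvT; exact: derive_nonvanishing_inj.
(* As [g] inverts [u] on [T], this function is v expressed through u; its derivative [y] below is
   v'/u'. *)
exists (v \o g); split=> [t Tt|K u0 itvK Ku0 KuT denomK]; first by rewrite /= gK.
pose y s := derive1 v (g s) / derive1 u (g s).
pose Z s := derive1 beta s ord0 ord_max.
have KI s : K s -> I s by move=> /KuT[t Tt <-]; have [] := hIv t Tt.
have ZE s : K s -> derive1 (x_last beta) s = Z s.
  by move=> /KI Is; rewrite (derive1_x_last hbeta Is).
have dw s : K s -> is_derive s 1 (v \o g) (y s).
  move=> /KuT[t Tt <-]; rewrite /y gK//; apply: is_derive1_comp (dg t Tt).
  by rewrite gK// derive1E; apply: DeriveDef => //; exact: (sv 0).
have cy s : K s -> {for s, continuous y}.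
  move=> /KuT[t Tt <-].
  have cg := is_derive1_continuous (dg t Tt).
  (* The first derivatives are continuous because they are themselves derivable. *)
  have c' (f : R -> R) : smooth_on T f -> {for u t, continuous (derive1 f \o g)}.
    move=> sf; apply: continuous_comp => //; rewrite gK//.
    by apply/differentiable_continuous/derivable1_diffP; exact: (sf 1).
  have u'g0 : derive1 u (g (u t)) != 0 by rewrite gK// u'0.
  have cV : {for u t, continuous (fun s => ((derive1 u \o g) s)^-1)}.
    by apply: continuousV; [exact: u'g0|exact: (c' u su)].
  exact: continuousM (c' v sv) cV.
have cX s : K s -> {for s, continuous (x_first beta)}.
  move=> /KI Is; have db := profile_derivable hbeta Is.
  exact: is_derive1_continuous (is_derive_coord ord0 db).
have cZ s : K s -> {for s, continuous Z}.
  move=> /KI Is; have [_ [sb _]] := hbeta.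
  exact: is_derive1_continuous (is_derive_coord ord_max (sb 1%N s Is)).
have surf s : K s -> eps * (x_first beta s ^+ 2 - c ^+ 2) < c ^+ 2 * Z s ^+ 2.
  by move=> /KI; exact: timelike_surface_ineq.
have slope s : K s ->
  (kap ^+ 2 * (x_first beta s ^+ 2 - c ^+ 2) + c ^+ 2 * Z s ^+ 2) * y s ^+ 2
  - 2 * c * Z s * (kap ^+ 2 + eps) * y s + eps * (kap ^+ 2 + eps) = 0.
  move=> Ks; rewrite -ZE//; move/KuT: Ks => [t Tt <-]; rewrite /y gK//.
  have [_ qE] := vel t Tt; have a0 := u'0 t Tt; move: qE => /=; rewrite -/kap.
  move: (derive1 u t) (derive1 v t) (derive1 (x_last beta) (u t)) a0.
  move=> a b z a0 qE.
  have a20 : a ^+ 2 != 0 by rewrite sqrf_eq0.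
  apply: (mulIf a20); rewrite mul0r.
  (* Multiplied by u'^2, the slope equation becomes the velocity identity. *)
  transitivity ((eps * a - c * z * b) ^+ 2 - - (eps * a ^+ 2 - 2 * c * z * a * b
    + (x_first beta (u t) ^+ 2 - c ^+ 2) * b ^+ 2) * kap ^+ 2).
    by field.
  by rewrite qE subrr.
have kap_ge0 : 0 <= kap.
  by rewrite /kap; case: ifP => _; [exact: sinh_ge0|rewrite ltW// cosh_gt0].
have denomKE s : K s -> denom beta c eps phi0 s =
    kap ^+ 2 * (x_first beta s ^+ 2 - c ^+ 2) + c ^+ 2 * Z s ^+ 2.
  by move=> Ks; rewrite denomE ZE.
(* Of sinh^2 and cosh^2, one is [kap ^+ 2] and the other [kap ^+ 2 + eps], so this is the
   double-angle formula squared. *)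
have k_eq : sinh (2 * phi0) ^+ 2 = 4 * kap ^+ 2 * (kap ^+ 2 + eps).
  rewrite sinh_double /kap; case: (eqVneq eps 1) => [->|].
    by rewrite /= -cosh_sqr; ring.
  case: hbeta => -[->|-> _ _]; first by rewrite eqxx.
  by rewrite /= cosh_sqr addrK -cosh_sqr; ring.
have eqN : (-1 == 1 :> R) = false by rewrite lt_eqF// (lt_trans _ ltr01)// oppr_lt0 ltr01.
have [D0|D0] := denomK.
  have [|kap0 [Xc wE]] := slope_degenerate eps2 itvK Ku0 dw cy surf slope kap_ge0.
    by move=> s Ks; rewrite -denomKE// D0.
  have [[eps1|eps1] _] := hbeta.
    by left; rewrite /kap eps1 eqxx in kap0 wE; split.
  by right; left; rewrite /kap eps1 eqN in kap0 wE; split.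
have {}D0 s : K s -> kap ^+ 2 * (x_first beta s ^+ 2 - c ^+ 2) + c ^+ 2 * Z s ^+ 2 != 0.
  by move=> Ks; rewrite -denomKE//; apply/eqP/D0.
have [sgn [sgnP wE]] := slope_nondegenerate eps2 itvK Ku0 dw cy surf slope cX cZ D0 k_eq.
have rad s : K s -> 0 <= sinh (2 * phi0) ^+ 2 *
    (c ^+ 2 * Z s ^+ 2 - eps * (x_first beta s ^+ 2 - c ^+ 2)).
  by move=> Ks; rewrite mulr_ge0 ?sqr_ge0// subr_ge0 ltW// surf.
(* The coefficient [kap ^+ 2 + eps] becomes cosh^2 in (iii) and sinh^2 in (iv). *)
right; right; have [[eps1|eps1] _] := hbeta.
- left; rewrite /kap eps1 eqxx -cosh_sqr in D0 wE; rewrite eps1 in rad.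
  have radE s : K s -> radicand_iii beta c phi0 s = sinh (2 * phi0) ^+ 2 *
      (c ^+ 2 * Z s ^+ 2 - 1 * (x_first beta s ^+ 2 - c ^+ 2)).
    by move=> Ks; rewrite /radicand_iii ZE//; ring.
  split; first by move=> s Ks; rewrite /denom_sinh ZE// D0.
  split; first by move=> s Ks; rewrite radE// rad.
  exists sgn; split=> // s Ks; rewrite wE//; congr (_ + _).
  by apply: (@eq_oriented_integral _ K) => // z Kz; rewrite radE// ZE.
- right; rewrite /kap eps1 eqN cosh_sqr addrK -cosh_sqr in D0 wE; rewrite eps1 in rad.
  have radE s : K s -> radicand_iv beta c phi0 s = sinh (2 * phi0) ^+ 2 *
      (c ^+ 2 * Z s ^+ 2 - -1 * (x_first beta s ^+ 2 - c ^+ 2)).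
    by move=> Ks; rewrite /radicand_iv ZE//; ring.
  split; first by move=> s Ks; rewrite /denom_cosh ZE// D0.
  split; first by move=> s Ks; rewrite radE// rad.
  exists sgn; split=> // s Ks; rewrite wE//; congr (_ + _).
  by apply: (@eq_oriented_integral _ K) => // z Kz; rewrite radE// ZE.
Qed.
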